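(* Let $k$ be a field, let $R=k[x,y,z]$ with the standard grading, and let $R/I$ be a standard graded Artinian Gorenstein algebra of codimension three, with Hilbert function $\underline{h}=(1,3,h_2,\dots,h_{c-1},h_c)$, where $c$ is the largest degree with $h_c\ne 0$. Let $n_1=\min\{t \mid \Delta^3\underline{h}(t)<0\}$, $n_2=\min\{t>0\mid \Delta^3\underline{h}(t)>0\}$, $N_1=\max\{t\le c+1\mid \Delta^3\underline{h}(t)<0\}$, $N_2=\max\{t\mid \Delta^3\underline{h}(t)>0\}$. Then the following conditions are equivalent: (1) $e(R/I)=\frac{1}{3!}\,n_1 n_2 (c+3)$. (2) $e(R/I)=\frac{1}{3!}\,N_1 N_2 (c+3)$. (3) $n_1=N_1$ and $n_2=N_2$. (That is, the Betti diagram of $R/I$ reduces to a pure one via formal cancellation.) (4) Among the integers $t$ with $1\le t\le c+2$ there is exactly one, $t_1$, with $\Delta^3\underline{h}(t_1)<0$ and exactly one, $t_2$, with $\Delta^3\underline{h}(t_2)>0$ (so $\Delta^3\underline{h}(t)=0$ for all other $t$ in this range); furthermore, $-\Delta^3\underline{h}(t_1)=\Delta^3\underline{h}(t_2)$ and $t_1+t_2=c+3$.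
   Context: $I\subset R$ is a homogeneous ideal; the Hilbert function is $h_t=\dim_k (R/I)_t$, with the convention $h_t=0$ for $t<0$ and for $t>c$. That $R/I$ has codimension three with $h_1=3$ means that $I$ contains no nonzero linear form. The third difference is $\Delta^3\underline{h}(t)=h_t-3h_{t-1}+3h_{t-2}-h_{t-3}$. The number $e(R/I)$ is the multiplicity (degree) of $R/I$; since $R/I$ is Artinian, $e(R/I)=\dim_k(R/I)=\sum_{t=0}^{c}h_t$. The parenthetical in (3) is a gloss on the numerical condition $n_1=N_1$, $n_2=N_2$: writing $\beta_{i,j}$ for the graded Betti numbers of $R/I$ (so $\Delta^3\underline{h}(t)=\beta_{2,t}-\beta_{1,t}-\beta_{3,t}$ for $t\ge1$), formal cancellation means numerically removing, in every degree $j$, all pairs of summands $R(-j)$ common to the first and second free modules of the minimal free resolution, whether or not the result is the resolution of an actual algebra; a Betti diagram is pure if in each homological degree $i$ at most one $\beta_{i,j}$ is nonzero. *)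

(* Defs.v *)
From HB Require Import structures.
From mathcomp Require Import all_boot all_order all_algebra.
From mathcomp Require Import mpoly.

Set Implicit Arguments.
Unset Strict Implicit.
Unset Printing Implicit Defensive.

Import Order.TTheory GRing.Theory Num.Theory.
Local Open Scope ring_scope.

(* For subspaces V, W of M: the classes of b_0, ..., b_(d-1) form a k-basis of *)
(* V / (V :&: W), i.e. of the image of V in M / W.                             *)
Definition quot_dim (k : fieldType) (M : lmodType k) (V W : {pred M})
    (d : nat) : Prop :=
  exists b : 'I_d -> M, (forall i, b i \in V) /\
    forall v, v \in V ->
      exists! a : 'rV[k]_d, v - \sum_(i < d) a 0 i *: b i \in W.

Section QuotientAlgebra.

Variables (k : fieldType) (n : nat).
Implicit Type I : idealr {mpoly k[n]}.

Definition homogeneous_ideal I : Prop :=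
  forall p, p \in I -> forall d : nat, pihomog mdeg d p \in I.

Definition hilbert_function I (h : nat -> nat) : Prop :=
  forall t : nat, quot_dim [pred p : {mpoly k[n]} | p \is t.-homog] I (h t).

(* Descending chain condition; ideals of R / I are ideals of R containing I. *)
(* An [idealr] is proper, but a chain starting at R itself is no obstacle.   *)
Definition artinian_quot I : Prop :=
  forall J : nat -> idealr {mpoly k[n]},
    (forall i, {subset I <= J i}) -> (forall i, {subset J i.+1 <= J i}) ->
    exists N, forall i, (N <= i)%N -> J i =i J N.

(* Preimage in R of the socle (0 : m) of R / I, where m = ('X_0, ..., 'X_(n-1)). *)
Definition socle_preim I : {pred {mpoly k[n]}} :=
  [pred p | [forall i : 'I_n, 'X_i * p \in I]].

Definition artinian_gorenstein_quot I : Prop :=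
  artinian_quot I /\ quot_dim (socle_preim I) I 1.

(* For Artinian R / I the multiplicity is dim_k (R / I). *)
Definition artinian_multiplicity I (e : nat) : Prop :=
  quot_dim (predT : {pred {mpoly k[n]}}) I e.

End QuotientAlgebra.

Definition hext (h : nat -> nat) (t : int) : int :=
  if t is Posz m then (h m)%:Z else 0.

Definition Delta3 (h : nat -> nat) (t : int) : int :=
  hext h t - 3 * hext h (t - 1) + 3 * hext h (t - 2) - hext h (t - 3).

Definition is_min (P : int -> Prop) (m : int) : Prop :=
  P m /\ forall t, P t -> m <= t.

Definition is_max (P : int -> Prop) (m : int) : Prop :=
  P m /\ forall t, P t -> t <= m.

(* Main.v *)
(* Write [s = c + 3] and [p = Delta3 h]. Gorenstein duality makes [h]
   symmetric, hence [p (s - t) = - p t], [N1 = s - n2] and [N2 = s - n1]; all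
   four conditions turn out to be equivalent to [n1 + n2 = s].

   Since the third difference of a cubic polynomial is constant,
     12 e - 2 s A = sum_(0 < t < s) - p t (s - 2 t) (t (s - t) - A)  for all A.
   If [2 n2 >= s], the weights [- p t (s - 2 t)] are nonnegative and
   [n1 n2 <= t (s - t) <= N1 N2] wherever they do not vanish, so equality in
   either bound forces [n1 = N1]. If [2 n2 < s], both bounds are strict; this
   uses that the second difference of [h] is 1 in degrees less than [n1] and
   nonpositive from [n1] on, up to the symmetry (Stanley's theorem).

   Stanley's theorem is obtained as follows. Let [K] be the fraction field of [R],
   let [L], [M] be two linear forms over [K] vanishing at the generic point
   (x : y : z), and let [r i] be the rank of [L] from degree [i] to degree [i + 1].
   Duality gives [r i = r (c - 1 - i)]. A form [f] of least degree [d] in [I]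
   does not vanish at the generic point, so [(L, M)] contains everything in
   degree at least [d] of [R / I]; hence [M] maps the cokernel of [L] in degree
   [i] onto its cokernel in degree [i + 1] when [i + 1 >= d], that is,
   [h (i + 1) - r i <= h i - r (i - 1)]. Adding this inequality to its mirror
   image under the duality eliminates the ranks and leaves the required
   concavity of [h]. Working over [K] avoids any assumption on [k]. *)

Require Import Defs.
From HB Require Import structures.
From mathcomp Require Import all_boot all_order all_algebra.
From mathcomp Require Import mpoly.
From mathcomp Require Import ring zify.

Set Implicit Arguments.
Unset Strict Implicit.
Unset Printing Implicit Defensive.

Import Order.TTheory GRing.Theory Num.Theory.
Local Open Scope ring_scope.

(** * Coordinates on the quotient *)

Section QuotientCoordinates.

Variables (k : fieldType) (n : nat) (I : idealr {mpoly k[n]}) (e : nat).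
Variable b : 'I_e -> {mpoly k[n]}.
Hypothesis b_basis : forall v : {mpoly k[n]},
  exists! a : 'rV[k]_e, v - \sum_(i < e) a 0 i *: b i \in I.

Lemma idealZ c p : p \in I -> c *: p \in I.
Proof. by move=> Ip; rewrite -mul_mpolyC idealMr. Qed.

Lemma qcoord_ex v : exists a : 'rV[k]_e, v - \sum_(i < e) a 0 i *: b i \in I.
Proof. by have [a [Ha _]] := b_basis v; exists a. Qed.

(** A linear map with kernel [I], having [qlift] as a section; through it [R / I] becomes the space
    of row vectors ['rV[k]_e]. *)
Definition qcoord v : 'rV[k]_e := xchoose (qcoord_ex v).

Definition qlift (a : 'rV[k]_e) : {mpoly k[n]} := \sum_(i < e) a 0 i *: b i.

Lemma qliftD : {morph qlift : a a' / a + a'}.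
Proof.
move=> a a'; rewrite /qlift -big_split; apply: eq_bigr => i _.
by rewrite mxE scalerDl.
Qed.

Lemma qliftZ c a : qlift (c *: a) = c *: qlift a.
Proof.
by rewrite /qlift scaler_sumr; apply: eq_bigr => i _; rewrite mxE scalerA.
Qed.

Lemma qcoordK v : v - qlift (qcoord v) \in I.
Proof. exact: xchooseP (qcoord_ex v). Qed.

Lemma qcoord_eq v a : v - qlift a \in I -> qcoord v = a.
Proof.
by move=> Ia; have [a0 [_ U]] := b_basis v; rewrite -(U _ Ia) -(U _ (qcoordK v)).
Qed.

Lemma qliftK a : qcoord (qlift a) = a.
Proof. by apply: qcoord_eq; rewrite subrr rpred0. Qed.

Lemma qcoord_is_linear : linear qcoord.
Proof.
move=> c u v; apply: qcoord_eq; rewrite qliftD qliftZ.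
have -> : c *: u + v - (c *: qlift (qcoord u) + qlift (qcoord v)) =
  c *: (u - qlift (qcoord u)) + (v - qlift (qcoord v)).
  by rewrite scalerBr opprD addrACA.
by rewrite rpredD ?idealZ ?qcoordK.
Qed.

HB.instance Definition _ :=
  GRing.isLinear.Build k {mpoly k[n]} 'rV[k]_e _ qcoord qcoord_is_linear.

Lemma qcoord0P v : reflect (qcoord v = 0) (v \in I).
Proof.
have ql0 : qlift 0 = 0 by rewrite -(scale0r 0) qliftZ scale0r.
apply: (iffP idP) => [Iv | v0]; first by apply: qcoord_eq; rewrite ql0 subr0.
by have := qcoordK v; rewrite v0 ql0 subr0.
Qed.

Lemma eq_qcoordP u v : reflect (qcoord u = qcoord v) (u - v \in I).
Proof.
apply: (iffP (qcoord0P _)) => [uv | uv]; last by rewrite linearB /= uv subrr.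
by apply/eqP; rewrite -subr_eq0 -linearB /= uv.
Qed.

(** Matrix of the endomorphism of [R / I] induced by a linear [f] that preserves [I]. It acts on row
    vectors from the right. *)
Definition qmx (f : {mpoly k[n]} -> {mpoly k[n]}) : 'M[k]_e :=
  \matrix_(i < e) qcoord (f (b i)).

Section OneMap.

Variable f : {linear {mpoly k[n]} -> {mpoly k[n]}}.
Hypothesis f_I : forall p, p \in I -> f p \in I.

Lemma qcoord_mulmx (p : {mpoly k[n]}) : qcoord p *m qmx f = qcoord (f p).
Proof.
have /f_I := qcoordK p; rewrite linearB => /eq_qcoordP ->.
rewrite /qlift !linear_sum mulmx_sum_row; apply: eq_bigr => i _.
by rewrite rowK !linearZ.
Qed.

End OneMap.

(** Every row vector is the coordinate vector of a polynomial, so identities between operators on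
    [R] pass to identities between matrices. *)
Lemma eq_qcoord_mulmx m (A B : 'M[k]_(e, m)) :
  (forall p : {mpoly k[n]}, qcoord p *m A = qcoord p *m B) -> A = B.
Proof.
move=> AB; apply/row_matrixP => i.
by rewrite !rowE -[delta_mx 0 i]qliftK.
Qed.

End QuotientCoordinates.

Arguments eq_qcoord_mulmx {k n I e b} b_basis {m A B}.

(** * Grading and Gorenstein duality *)

Lemma pihomogMX (R : comNzRingType) n (s : 'I_n) i (p : {mpoly R[n]}) :
  pihomog mdeg i.+1 ('X_s * p) = 'X_s * pihomog mdeg i p.
Proof.
elim/mpolyind: p => [|c m p _ _ IHp]; first by rewrite mulr0 !linear0 mulr0.
rewrite mulrDr !linearD /= mulrDr IHp -scalerAr !linearZ /= -scalerAr.
rewrite -mpolyXD !pihomogX /= mdegD mdeg1 add1n eqSS.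
by case: eqP => _; rewrite ?mpolyXD ?mulr0.
Qed.

Definition mulvar (R : comNzRingType) n (s : 'I_n) (p : {mpoly R[n]}) := 'X_s * p.

Lemma mulvar_is_linear (R : comNzRingType) n (s : 'I_n) : linear (@mulvar R n s).
Proof. by move=> c p q; rewrite /mulvar mulrDr scalerAr. Qed.

HB.instance Definition _ (R : comNzRingType) n (s : 'I_n) :=
  GRing.isLinear.Build R {mpoly R[n]} {mpoly R[n]} _ (@mulvar R n s)
    (@mulvar_is_linear R n s).

Section GradedQuotient.

Variables (k : fieldType) (n : nat) (I : idealr {mpoly k[n]}) (e : nat).
Variable b : 'I_e -> {mpoly k[n]}.
Hypothesis b_basis : forall v : {mpoly k[n]},
  exists! a : 'rV[k]_e, v - \sum_(i < e) a 0 i *: b i \in I.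
Hypothesis I_homog : homogeneous_ideal I.

Local Notation kappa := (qcoord b_basis).

(** The projector of [R / I] onto its degree [i] component; its row space stands for that
    component. *)
Definition degmx i : 'M[k]_e := qmx b_basis (pihomog mdeg i).
Definition varmx s : 'M[k]_e := qmx b_basis (@mulvar k n s).

Lemma qcoord_degmx p i : kappa p *m degmx i = kappa (pihomog mdeg i p).
Proof. by apply: (qcoord_mulmx b_basis) => q Iq; exact: I_homog. Qed.

Lemma qcoord_degmx_homog p i : p \is i.-homog -> kappa p *m degmx i = kappa p.
Proof. by move=> hp; rewrite qcoord_degmx pihomog_dE. Qed.

Lemma qcoord_varmx p s : kappa p *m varmx s = kappa ('X_s * p).
Proof. by apply: (qcoord_mulmx b_basis) => q Iq; exact: idealMr. Qed.

Lemma varmxC s t : varmx s *m varmx t = varmx t *m varmx s.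
Proof.
apply: (eq_qcoord_mulmx b_basis) => p.
by rewrite !mulmxA !qcoord_varmx mulrCA.
Qed.

Lemma varmx_degmx s i : varmx s *m degmx i.+1 = degmx i *m varmx s.
Proof.
apply: (eq_qcoord_mulmx b_basis) => p.
by rewrite !mulmxA !(qcoord_varmx, qcoord_degmx) pihomogMX.
Qed.

Lemma degmx_mul i j : degmx i *m degmx j = if i == j then degmx i else 0.
Proof.
apply: (eq_qcoord_mulmx b_basis) => p; rewrite mulmxA !qcoord_degmx.
have [<- | ij] := eqVneq; first by rewrite pihomog_id qcoord_degmx.
by rewrite (pihomog_ne0 ij (pihomogP _ _ _)) linear0 mulmx0.
Qed.

Variable h : nat -> nat.
Hypothesis I_hilb : hilbert_function I h.

(** The coordinate vectors of a basis of the degree [t] component span the row space of the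
    projector; they are independent because 0 has unique coordinates in that basis. *)
Lemma rank_degmx t : \rank (degmx t) = h t.
Proof.
have [v [v_homog vP]] := I_hilb t.
pose M := \matrix_(i < h t) kappa (v i).
have kM (a : 'rV_(h t)) : a *m M = kappa (\sum_i a 0 i *: v i).
  rewrite linear_sum mulmx_sum_row; apply: eq_bigr => i _.
  by rewrite rowK linearZ.
have freeM : row_free M.
  rewrite -kermx_eq0; apply/rowV0P => a /sub_kermxP.
  rewrite kM => /qcoord0P Ia.
  have [|a0 [_ U]] := vP 0; first by rewrite inE rpred0.
  rewrite -(U a) ?sub0r ?rpredN //; apply: U.
  by rewrite big1 ?subr0 ?rpred0 // => i _; rewrite mxE scale0r.
suffices eqM : (degmx t :=: M)%MS by rewrite eqM (eqP freeM).
apply/eqmxP/andP; split; apply/row_subP => i; rewrite rowK.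
  have [|a [Ia _]] := vP (pihomog mdeg t (b i)); first exact: pihomogP.
  by move/eq_qcoordP: Ia => ->; rewrite -kM submxMl.
have /qcoord_degmx_homog <- : v i \is t.-homog by have := v_homog i.
exact: submxMl.
Qed.

Variable c : nat.
Hypothesis h_gt_c : forall t, (c < t)%N -> h t = 0%N.

Lemma degmx_gt i : (c < i)%N -> degmx i = 0.
Proof. by move=> /h_gt_c hi; apply/eqP; rewrite -mxrank_eq0 rank_degmx hi. Qed.

Lemma homog_gt_in_ideal p i : (c < i)%N -> p \is i.-homog -> p \in I.
Proof.
move=> ci hp; apply/(qcoord0P b_basis).
by rewrite -(qcoord_degmx_homog hp) degmx_gt ?mulmx0.
Qed.

Lemma sum_degmx : \sum_(i < c.+1) degmx i = 1%:M.
Proof.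
apply: (eq_qcoord_mulmx b_basis) => p; rewrite mulmx1 mulmx_sumr.
(* Large enough to exceed both [c] and the degree of [p], so the sum of homogeneous components is
   complete before it is cut at [c]. *)
pose N := (c.+1 + mmeasure mdeg p)%N.
rewrite {2}(pihomog_partitionE (leq_addl c.+1 _ : _ <= N)%N) linear_sum.
rewrite (big_ord_widen N (fun i => kappa p *m degmx i)) ?leq_addr //.
rewrite big_mkcond; apply: eq_bigr => i _.
by rewrite /= -qcoord_degmx; case: ltnP => // ci; rewrite degmx_gt ?mulmx0.
Qed.

Hypothesis h_c : h c <> 0%N.
Hypothesis socle1 : quot_dim (socle_preim I) I 1.

Lemma homog_c_socle p : p \is c.-homog -> p \in socle_preim I.
Proof.
move=> hp; apply/forallP => s; apply: (@homog_gt_in_ideal _ c.+1) => //.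
by rewrite -add1n dhomogM // dhomogX /= mdeg1.
Qed.

(** The degree [c] component is nonzero and lies in the one-dimensional socle, so every socle
    element is, modulo [I], a multiple of one form [p0] of degree [c]. Any coordinate in which [p0]
    is nonzero serves as the functional. *)
Lemma socle_functional :
  exists l : 'cV[k]_e, forall p, p \in socle_preim I ->
    p \notin I -> kappa (pihomog mdeg c p) *m l != 0.
Proof.
have [v [v_soc vP]] := socle1.
have socE p : p \in socle_preim I -> exists a, kappa p = a *: kappa (v 0).
  move=> /vP [a [Ia _]]; exists (a 0 0); rewrite big_ord1 in Ia.
  by move/(eq_qcoordP b_basis): Ia => ->; rewrite linearZ.
have [p0 hp0 p0I] : exists2 p, p \is c.-homog & p \notin I.
  have /rowV0Pn[x /submxP[y ->] nz] : degmx c != 0.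
    by rewrite -mxrank_eq0 rank_degmx; apply/eqP.
  exists (pihomog mdeg c (qlift b y)); first exact: pihomogP.
  apply: contra nz => /(qcoord0P b_basis) yI.
  by rewrite -[y](qliftK b_basis) qcoord_degmx yI.
have [a0 kp0] := socE _ (homog_c_socle hp0).
have a0_neq0 : a0 != 0.
  apply: contra p0I => /eqP a00; apply/(qcoord0P b_basis).
  by rewrite kp0 a00 scale0r.
have kv : kappa (v 0) = a0^-1 *: kappa p0 by rewrite kp0 scalerA mulVf ?scale1r.
have : kappa p0 != 0 by apply: contra p0I => /eqP /qcoord0P.
case/rV0Pn => j p0j; exists (delta_mx j 0) => p p_soc pI.
have [a kp] := socE _ p_soc.
have -> : kappa (pihomog mdeg c p) = kappa p.
  by rewrite -qcoord_degmx kp kv -!scalemxAl qcoord_degmx_homog.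
apply: contra pI => /eqP /matrixP /(_ 0 0).
rewrite -colE !mxE => pj; apply/(qcoord0P b_basis).
move: pj; rewrite kp kv !mxE => /eqP.
rewrite !mulf_eq0 invr_eq0 (negPf a0_neq0) (negPf p0j) !orbF => /eqP ->.
by rewrite scale0r.
Qed.

(** An element outside [I] that is not in the socle has a product with some variable outside [I].
    This can be repeated only finitely often, since forms of degree above [c] lie in [I]. *)
Lemma socle_multiple p : p \notin I ->
  exists q, (p * q \in socle_preim I) && (p * q \notin I).
Proof.
suffices H N : forall p, p \notin I ->
    (forall q, q \is N.-homog -> p * q \in I) ->
  exists q, (p * q \in socle_preim I) && (p * q \notin I).
  move=> pI; apply: (H c.+1) => // q hq; apply: idealMr.
  exact: homog_gt_in_ideal hq.
elim: N => [|N IHN] {}p pI pN.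
  by have := pN 1 (dhomog1 _ _); rewrite mulr1 (negPf pI).
have [p_soc | /forallPn[s sp]] := boolP (p \in socle_preim I).
  by exists 1; rewrite mulr1 p_soc.
have [|q] := IHN _ sp.
  move=> q hq; rewrite -mulrA mulrCA; apply: pN.
  by rewrite -add1n dhomogM // dhomogX /= mdeg1.
by move=> sq; exists ('X_s * q); rewrite mulrA [p * _]mulrC.
Qed.

(** [B] is the Gram matrix of the form sending [(p, q)] to the socle functional of the degree [c]
    part of [p * q]. It is nondegenerate because each nonzero class has a nonzero multiple in the
    socle, and multiplication by a variable is self-adjoint for it. *)
Lemma gorenstein_pairing : exists B : 'M[k]_e,
  [/\ B \in unitmx, B^T = B,
      forall s, varmx s *m B = B *m (varmx s)^T &
      forall i j, (i + j != c)%N -> degmx i *m B *m (degmx j)^T = 0].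
Proof.
have [l lP] := socle_functional.
pose lam p := (kappa (pihomog mdeg c p) *m l) 0 0.
have lamD : {morph lam : p q / p + q}.
  by move=> p q; rewrite /lam !linearD mulmxDl mxE.
have lamZ a p : lam (a *: p) = a * lam p.
  by rewrite /lam !linearZ /= -scalemxAl mxE.
have lam0 p : p \in I -> lam p = 0.
  by move=> /I_homog /(_ c) /(qcoord0P b_basis); rewrite /lam => ->; rewrite mul0mx mxE.
have lam_sum m (F : 'I_m -> {mpoly k[n]}) : lam (\sum_i F i) = \sum_i lam (F i).
  by rewrite (big_morph lam lamD (lam0 _ (rpred0 _))).
have lam_lift p q : lam (p * q) = lam (p * qlift b (kappa q)).
  rewrite -[q in LHS](subrK (qlift b (kappa q))) mulrDr lamD lam0 ?add0r //.
  by apply: idealMr; exact: qcoordK.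
pose B : 'M[k]_e := \matrix_(i, j) lam (b i * b j).
have BE p q : (kappa p *m B *m (kappa q)^T) 0 0 = lam (p * q).
  rewrite lam_lift mulrC lam_lift /qlift mulr_suml lam_sum !mxE.
  apply: eq_bigr => j _; rewrite mxE -scalerAl lamZ mulrC !mxE; congr (_ * _).
  rewrite mulr_sumr lam_sum; apply: eq_bigr => i _.
  by rewrite -scalerAr lamZ !mxE mulrC [b i * _]mulrC mulrC.
have eqB (A A' : 'M_e) : (forall p q, (kappa p *m A *m (kappa q)^T) 0 0 =
    (kappa p *m A' *m (kappa q)^T) 0 0) -> A = A'.
  move=> AA'; apply: (eq_qcoord_mulmx b_basis) => p.
  apply: trmx_inj; apply: (eq_qcoord_mulmx b_basis) => q.
  apply: trmx_inj; rewrite !trmx_mul !trmxK.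
  by apply/matrixP => i j; rewrite !ord1 AA'.
exists B; split.
- rewrite -row_free_unit -kermx_eq0; apply/rowV0P => y /sub_kermxP.
  rewrite -[y](qliftK b_basis); set p := qlift b y => pB.
  apply/(qcoord0P b_basis); apply/negPn/negP => /socle_multiple[q /andP[q_soc qI]].
  have /eqP[] := lP _ q_soc qI; apply/matrixP => i j; rewrite !ord1.
  by rewrite -/(lam (p * q)) -BE pB mul0mx mxE.
- by apply/matrixP => i j; rewrite !mxE mulrC.
- move=> s; apply: eqB => p q.
  rewrite !mulmxA -[_ *m (varmx s)^T *m _]mulmxA -trmx_mul !qcoord_varmx !BE.
  by rewrite mulrCA mulrA.
- move=> i j ij; apply: eqB => p q.
  rewrite !mulmxA -[_ *m (degmx j)^T *m _]mulmxA -trmx_mul !qcoord_degmx BE.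
  rewrite mulmx0 mul0mx mxE /lam (pihomog_ne0 ij) ?linear0 ?mul0mx ?mxE //.
  by apply: dhomogM; exact: pihomogP.
Qed.

End GradedQuotient.

(** * Ranks of a linear form *)

Section FormCokernel.

Variables (F : fieldType) (e : nat) (D : nat -> 'M[F]_e) (L : 'M[F]_e).
Hypothesis L_deg : forall i, L *m D i.+1 = D i *m L.

Lemma degmx_mul_sub i : (D i *m L <= D i.+1)%MS.
Proof. by rewrite -L_deg submxMl. Qed.

(** [W] represents the cokernel of [L] in degree [i + 1]. As [M] commutes with [L], it sends the
    image [V] of [L] into the next image of [L], so [W *m M] alone must generate the next
    cokernel. *)
Lemma coker_form_noninc (M : 'M[F]_e) i : (forall j, M *m D j.+1 = D j *m M) ->
    L *m M = M *m L -> (D i.+2 <= D i.+1 *m L + D i.+1 *m M)%MS ->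
  (\rank (D i.+2) + \rank (D i *m L) <= \rank (D i.+1) + \rank (D i.+1 *m L))%N.
Proof.
move=> M_deg LM DLM.
pose V := (D i *m L)%R; pose W := (D i.+1 :\: V)%MS.
have V_sub : (V <= D i.+1)%MS := degmx_mul_sub i.
have rkW : (\rank V + \rank W = \rank (D i.+1))%N.
  by rewrite -(mxrank_cap_compl (D i.+1) V) (capmx_idPr V_sub).
have DVW : (D i.+1 <= V + W)%MS.
  by rewrite -(addsmx_diff_cap_eq (D i.+1) V) addsmxC addsmxS ?capmxSr.
have VM : (V *m M <= D i.+1 *m L)%MS.
  by rewrite /V -mulmxA LM mulmxA submxMr // -M_deg submxMl.
have {DLM} /mxrankS rkD : (D i.+2 <= D i.+1 *m L + W *m M)%MS.
  apply: submx_trans DLM _; rewrite addsmx_sub addsmxSl /=.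
  by rewrite (submx_trans (submxMr M DVW)) // addsmxMr addsmxS.
have := leq_trans rkD (mxrank_adds_leqif _ _); have := mxrankM_maxl W M.
rewrite -/V -rkW; lia.
Qed.

End FormCokernel.

Section GradedPairing.

Variables (F : fieldType) (e c : nat) (D : nat -> 'M[F]_e) (B : 'M[F]_e).
Hypothesis D_mul : forall i j, D i *m D j = if i == j then D i else 0.
Hypothesis D_sum : \sum_(i < c.+1) D i = 1%:M.
Hypothesis B_unit : B \in unitmx.
Hypothesis B_sym : B^T = B.
Hypothesis B_graded : forall i j, (i + j != c)%N -> D i *m B *m (D j)^T = 0.

Lemma sub_degmx m (V : 'M_(m, e)) i : (V <= D i)%MS -> V *m D i = V.
Proof. by case/submxP => Y ->; rewrite -mulmxA D_mul eqxx. Qed.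

Lemma sum_rank_degmx : (\sum_(i < c.+1) \rank (D i) = e)%N.
Proof.
have direct : mxdirect (\sum_(i < c.+1) D i).
  apply/mxdirect_sumsP => i _; set W := (_ :&: _)%MS.
  rewrite -(sub_degmx (capmxSl _ _ : W <= D i)%MS).
  apply/eqP; rewrite -submx0; apply: submx_trans (submxMr (D i) (capmxSr _ _)) _.
  rewrite sumsmxMr; apply/sumsmx_subP => j /andP[_ ji].
  by rewrite D_mul (negPf (_ : val j != val i)) ?sub0mx.
rewrite -(mxdirectP direct) /=; apply/eqP; rewrite eqn_leq rank_leq_col.
rewrite -{1}(mxrank1 F e); apply: mxrankS; rewrite -D_sum.
by apply: summx_sub => i _; rewrite (sumsmx_sup i).
Qed.

(** A degree [i] vector orthogonal to degree [j = c - i] is orthogonal to every degree, hence zero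
    as [B] is invertible. Pairing with degree [j] is thus injective on [V]. *)
Lemma rank_pairing m (V : 'M_(m, e)) i j :
  (i + j = c)%N -> (V <= D i)%MS -> \rank (V *m (B *m (D j)^T)) = \rank V.
Proof.
move=> ijc VD; rewrite -(mxrank_mul_ker V (B *m (D j)^T)).
set W := (V :&: _)%MS; suffices -> : W = 0 by rewrite mxrank0 addn0.
have WD : W *m D i = W by apply: sub_degmx; apply: submx_trans VD; exact: capmxSl.
have WN : W *m (B *m (D j)^T) = 0 by apply/sub_kermxP; exact: capmxSr.
have WB : W *m B = 0.
  rewrite -[W *m B]mulmx1 -trmx1 -D_sum linear_sum mulmx_sumr big1 //= => l _.
  have [<- | jl] := eqVneq j l; first by rewrite -mulmxA.
  have : (i + l != i + j)%N by rewrite eqn_add2l eq_sym.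
  rewrite ijc => /B_graded Dil.
  by rewrite -WD -[W *m _ *m B]mulmxA -[W *m _ *m _]mulmxA Dil mulmx0.
by rewrite -[W](mulmxK B_unit) WB mul0mx.
Qed.

Lemma rank_degmx_sym i j : (i + j = c)%N -> \rank (D i) = \rank (D j).
Proof.
move=> ijc; rewrite -(rank_pairing ijc (submx_refl _)).
rewrite -mxrank_tr trmx_mul trmx_mul trmxK B_sym -mulmxA.
by apply: rank_pairing; rewrite // addnC.
Qed.

Section OneForm.

Variable L : 'M[F]_e.
Hypothesis L_deg : forall i, L *m D i.+1 = D i *m L.

(** By self-adjointness of [L], the matrices pairing [D i *m L] with [D j] and [D j *m L] with [D i]
    are transposes of each other. *)
Lemma rank_form_sym i j : L *m B = B *m L^T -> (i + j.+1 = c)%N ->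
  \rank (D i *m L) = \rank (D j *m L).
Proof.
move=> LB ijc.
have ijc1 : (i.+1 + j = c)%N by rewrite -ijc addSnnS.
have ijc2 : (j.+1 + i = c)%N by rewrite addnC.
rewrite -(rank_pairing ijc1 (degmx_mul_sub L_deg i)).
rewrite -(rank_pairing ijc2 (degmx_mul_sub L_deg j)).
rewrite -mxrank_tr !trmx_mul trmxK B_sym !mulmxA; congr (\rank (_ *m _)).
by rewrite -!mulmxA LB.
Qed.

End OneForm.

End GradedPairing.

(** * The generic point *)

Section LinearForms.

Variables (K : fieldType) (n e : nat) (X : 'I_n.+1 -> 'M[K]_e) (w : 'I_n.+1 -> K).
Hypothesis X_comm : forall s t, comm_mx (X s) (X t).

(** Multiplication by a linear form vanishing at the point [w]; when [w ord0] is nonzero, these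
    forms span all linear forms vanishing there. *)
Definition lform s : 'M[K]_e := w ord0 *: X s - w s *: X ord0.

Lemma comm_mxZ (A C : 'M[K]_e) a : comm_mx A C -> comm_mx A (a *: C).
Proof. by rewrite /comm_mx => ACc; rewrite -scalemxAl -scalemxAr ACc. Qed.

Lemma lform_commX s t : comm_mx (X t) (lform s).
Proof. by apply: comm_mxB; apply: comm_mxZ. Qed.

Lemma lform_comm s t : comm_mx (lform s) (lform t).
Proof. by apply: comm_mxB; apply: comm_mxZ; apply/comm_mx_sym/lform_commX. Qed.

Lemma lform0 : lform ord0 = 0.
Proof. exact: subrr. Qed.

Lemma lform_deg (A C : 'M[K]_e) s :
  (forall t, X t *m A = C *m X t) -> lform s *m A = C *m lform s.
Proof.
move=> XAC; rewrite /lform mulmxBl mulmxBr.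
by rewrite -!scalemxAl -!scalemxAr !XAC.
Qed.

Lemma lform_pairing (B : 'M[K]_e) s :
  (forall t, X t *m B = B *m (X t)^T) -> lform s *m B = B *m (lform s)^T.
Proof.
move=> XB; have -> : (lform s)^T = w ord0 *: (X s)^T - w s *: (X ord0)^T.
  by rewrite /lform linearB !linearZ.
by rewrite /lform mulmxBl mulmxBr -!scalemxAl -!scalemxAr !XB.
Qed.

(** The row space of a multiplication matrix is a principal ideal of the quotient algebra, so this
    sum is the ideal generated by all the [lform s]. *)
Definition lideal : 'M[K]_e := (\sum_s lform s)%MS.

Lemma lideal_mulX m (y : 'M_(m, e)) s : (y <= lideal)%MS -> (y *m X s <= lideal)%MS.
Proof.
move=> yW; apply: submx_trans (submxMr _ yW) _.
rewrite sumsmxMr; apply/sumsmx_subP => t _; rewrite (sumsmx_sup t) //.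
by rewrite -(lform_commX t s) submxMl.
Qed.

(* Modulo the linear forms vanishing at [w], [X s] is [w s / w ord0] times
   [X ord0]. *)
Lemma lideal_step (y z : 'rV_e) a a' s : (a *: y - a' *: z <= lideal)%MS ->
  ((w ord0 * a) *: (y *m X s) - (w s * a') *: (z *m X ord0) <= lideal)%MS.
Proof.
move=> yzW.
have -> : (w ord0 * a) *: (y *m X s) - (w s * a') *: (z *m X ord0) =
  a *: (y *m lform s) + w s *: ((a *: y - a' *: z) *m X ord0).
  rewrite /lform mulmxBl mulmxBr -!scalemxAl -!scalemxAr.
  move: (y *m X s) (y *m X ord0) (z *m X ord0) => y1 y2 z1.
  by apply/rowP => i; rewrite !mxE; ring.
rewrite addmx_sub ?scalemx_sub ?lideal_mulX //.
by rewrite (submx_trans (submxMl _ _)) // (sumsmx_sup s).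
Qed.

End LinearForms.

Lemma mnmUD_ind n (P : 'X_{1..n} -> Prop) :
  P 0%MM -> (forall s m, P m -> P (U_(s) + m)%MM) -> forall m, P m.
Proof.
move=> P0 PU m; have [N] := ubnP (mdeg m); elim: N m => // N IHN m mN.
have [/eqP | m_neq0] := eqVneq (mdeg m) 0%N; first by rewrite mdeg_eq0 => /eqP ->.
have [s ms] : exists s, m s != 0%N.
  apply/existsP; apply: contraNT m_neq0; rewrite negb_exists => /forallP ms0.
  by rewrite mdegE big1 // => s _; apply/eqP; rewrite -[_ == _]negbK ms0.
have mE : (m = U_(s) + (m - U_(s)))%MM by rewrite addmC submK // lep1mP.
move: mN; rewrite mE; set m' := (m - _)%MM.
by rewrite mdegD mdeg1 add1n ltnS => /IHN; exact: PU.
Qed.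

Section GenericPoint.

Variables (k : fieldType) (n : nat) (I : idealr {mpoly k[n.+1]}) (e : nat).
Variable b : 'I_e -> {mpoly k[n.+1]}.
Hypothesis b_basis : forall v : {mpoly k[n.+1]},
  exists! a : 'rV[k]_e, v - \sum_(i < e) a 0 i *: b i \in I.
Hypothesis I_homog : homogeneous_ideal I.

Variables (K : fieldType) (iota : {rmorphism k -> K}).
Variable ev : {rmorphism {mpoly k[n.+1]} -> K}.
Hypothesis evC : forall a, ev a%:MP = iota a.

(** The class of [p] after extending scalars along [iota]. The variables now occur twice: as
    operators [Kvarmx s] on this space and as scalars [ev 'X_s] in [K]. *)
Definition vec p : 'rV[K]_e := map_mx iota (qcoord b_basis p).
Definition Kvarmx s : 'M[K]_e := map_mx iota (varmx b_basis s).
Definition Kdegmx i : 'M[K]_e := map_mx iota (degmx b_basis i).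

Local Notation point := (fun s => ev 'X_s).
Local Notation W := (lideal Kvarmx point).

Lemma Kvarmx_comm s t : comm_mx (Kvarmx s) (Kvarmx t).
Proof. by rewrite /comm_mx -!map_mxM varmxC. Qed.

Lemma vec_varmx p s : vec p *m Kvarmx s = vec ('X_s * p).
Proof. by rewrite -map_mxM qcoord_varmx. Qed.

Lemma vec_sum (J : Type) (r : seq J) (f : J -> k) (F : J -> {mpoly k[n.+1]}) :
  vec (\sum_(j <- r) f j *: F j) = \sum_(j <- r) iota (f j) *: vec (F j).
Proof.
elim: r => [|j r IHr]; first by rewrite !big_nil /vec linear0 map_mx0.
by rewrite !big_cons -IHr /vec linearP map_mxD map_mxZ.
Qed.

Lemma vec_monomial m :
  (point ord0 ^+ mdeg m *: vec 'X_[m] - ev 'X_[m] *: vec ('X_ord0 ^+ mdeg m) <= W)%MS.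
Proof.
elim/mnmUD_ind: m => [|s m IHm].
  by rewrite mdeg0 expr0 mpolyX0 rmorph1 subrr sub0mx.
rewrite mdegD mdeg1 add1n mpolyXD !exprS -!vec_varmx rmorphM.
exact: (lideal_step Kvarmx_comm s IHm).
Qed.

Lemma vec_homog p d : p \is d.-homog ->
  (point ord0 ^+ d *: vec p - ev p *: vec ('X_ord0 ^+ d) <= W)%MS.
Proof.
move=> /dhomogP hp; rewrite [p]mpolyE vec_sum rmorph_sum scaler_sumr scaler_suml.
rewrite -sumrB big_seq; apply: summx_sub => m /hp /= <-.
rewrite -mul_mpolyC rmorphM evC scalerA mulrC -!scalerA -scalerBr scalemx_sub //.
exact: vec_monomial.
Qed.

Hypothesis point_neq0 : ev 'X_ord0 != 0.

(** Modulo [W] a form of degree [d] is its value at the point times a power of the first variable,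
    up to a nonzero scalar. Since [f] is zero in the quotient but not at the point, that power lies
    in [W], and with it every form of degree at least [d]. *)
Lemma generic_generation f d i : f \in I -> f \is d.-homog -> ev f != 0 ->
  (d <= i.+1)%N ->
  (Kdegmx i.+1 <= \sum_s (Kdegmx i *m lform Kvarmx point s))%MS.
Proof.
move=> If hf evf di.
have vecI p : p \in I -> vec p = 0.
  by move=> /(qcoord0P b_basis) Ip; rewrite /vec Ip map_mx0.
have X0d : (vec ('X_ord0 ^+ d) <= W)%MS.
  have := vec_homog hf; rewrite vecI // scaler0 sub0r -scaleNr.
  by move/(scalemx_sub (- ev f)^-1); rewrite scalerA mulVf ?oppr_eq0 // scale1r.
have X0i : (vec ('X_ord0 ^+ i.+1) <= W)%MS.
  rewrite -(subnK di); elim: (i.+1 - d)%N => [|l IHl]; first by rewrite add0n.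
  by rewrite addSn exprS -vec_varmx; apply: lideal_mulX => //; exact: Kvarmx_comm.
have homW p : p \is i.+1.-homog -> (vec p <= W)%MS.
  move=> /vec_homog hp; rewrite -(scale1r (vec p)).
  rewrite -(mulVf (expf_neq0 i.+1 point_neq0)) -scalerA scalemx_sub //.
  by rewrite -(subrK (ev p *: vec ('X_ord0 ^+ i.+1)) (_ *: _)) addmx_sub ?scalemx_sub.
have DW : (Kdegmx i.+1 <= W)%MS.
  apply/row_subP => j; rewrite -map_row rowK; apply: homW; exact: pihomogP.
have DD : Kdegmx i.+1 *m Kdegmx i.+1 = Kdegmx i.+1.
  by rewrite -map_mxM degmx_mul // eqxx.
(* Each [lform] raises degrees by one, so projecting [W] to degree [i + 1] leaves only the images of
   degree [i]. *)
rewrite -{1}DD (submx_trans (submxMr _ DW)) // sumsmxMr.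
apply/sumsmx_subP => s _; rewrite (sumsmx_sup s) //.
rewrite (@lform_deg _ _ _ _ _ _ (Kdegmx i)) // => t.
by rewrite -!map_mxM varmx_degmx.
Qed.

End GenericPoint.

(** * Comparison of the Hilbert function with that of the polynomial ring *)

Section PolynomialRingDimension.

Variables (k : fieldType) (n : nat) (I : idealr {mpoly k[n.+1]}).
Variables (h : nat -> nat) (e t : nat).
Hypothesis I_homog : homogeneous_ideal I.
Hypothesis I_hilb : hilbert_function I h.
Hypothesis I_mult : artinian_multiplicity I e.

(** [M] is the matrix of the quotient map on a basis of the forms of degree [t]: its row space is
    the degree [t] part of [R / I] and its left kernel describes the forms of [I]. *)
Lemma hilbert_relation : exists N N' (M : 'M[k]_(N, N')),
  [/\ N = 'C(t + n, t), \rank M = h t & forall a : 'rV_N, a != 0 -> a *m M = 0 ->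
    exists f, [/\ f \in I, f \is t.-homog & f != 0]].
Proof.
have [b [_ b_basis0]] := I_mult.
have b_basis v : exists! a : 'rV[k]_e, v - \sum_(i < e) a 0 i *: b i \in I.
  exact: b_basis0.
pose X := vbasis {: dhomog n.+1 k t}.
have X_free : free X by exact: basis_free (vbasisP fullv).
exists (\dim {: dhomog n.+1 k t}), e, (\matrix_i qcoord b_basis (tnth X i)).
set M := \matrix_i _.
have aM a : a *m M = qcoord b_basis (val (\sum_i a 0 i *: X`_i)).
  rewrite mulmx_sum_row (big_morph val (id1 := 0) (op1 := +%R)) // linear_sum.
  by apply: eq_bigr => i _; rewrite rowK (tnth_nth 0) -linearZ.
split=> [||a a0]; first exact: dimvf.
  rewrite -(rank_degmx b_basis I_homog I_hilb); apply/eqmx_rank/andP; split.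
    apply/row_subP => i; rewrite rowK.
    by rewrite -(qcoord_degmx_homog b_basis I_homog (valP (tnth X i))) submxMl.
  apply/row_subP => i; rewrite rowK.
  pose p := DHomog (pihomogP mdeg t (b i)).
  rewrite -[pihomog _ _ _]/(val p) (coord_vbasis (memvf p)).
  have -> : \sum_i coord (vbasis fullv) i p *: (vbasis fullv)`_i =
     \sum_i (\row_i coord X i p) 0 i *: X`_i.
    by apply: eq_bigr => j _; rewrite mxE.
  by rewrite -aM submxMl.
rewrite aM => /(qcoord0P b_basis) fI.
exists (val (\sum_i a 0 i *: X`_i)); split; [exact: fI | exact: valP |].
apply: contra a0 => /eqP f0; apply/eqP/rowP => i; rewrite mxE.
by apply: (freeP X_free (fun j => a 0 j)); exact: val_inj.
Qed.

Lemma hilbert_le_binomial : (h t <= 'C(t + n, t))%N.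
Proof. by have [N [N' [M [<- <- _]]]] := hilbert_relation; exact: rank_leq_row. Qed.

Lemma hilbert_lt_binomial : (h t < 'C(t + n, t))%N ->
  exists f, [/\ f \in I, f \is t.-homog & f != 0].
Proof.
have [N [N' [M [<- <- H]]]] := hilbert_relation.
move=> rkM; have /rowV0Pn[a /sub_kermxP aM a0] : kermx M != 0.
  by rewrite kermx_eq0 /row_free neq_ltn rkM.
exact: H a0 aM.
Qed.

End PolynomialRingDimension.

(** * Duality and rank inequalities for a Gorenstein quotient in three variables *)

Section GorensteinRanks.

Variables (k : fieldType) (I : idealr {mpoly k[3]}) (h : nat -> nat) (c e : nat).
Hypothesis I_homog : homogeneous_ideal I.
Hypothesis I_gor : artinian_gorenstein_quot I.
Hypothesis I_hilb : hilbert_function I h.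
Hypothesis h_c : h c <> 0%N.
Hypothesis h_gt_c : forall t : nat, (c < t)%N -> h t = 0%N.
Hypothesis I_mult : artinian_multiplicity I e.

Lemma gorenstein_ranks d f : f \in I -> f \is d.-homog -> f != 0 ->
  [/\ forall i j, (i + j = c)%N -> h i = h j,
      e = (\sum_(t < c.+1) h t)%N &
      exists r : nat -> nat,
        (forall i j, (i + j.+1 = c)%N -> r i = r j) /\
        forall i, (d <= i.+2)%N -> (h i.+2 + r i <= h i.+1 + r i.+1)%N].
Proof.
move=> If hf f0; have [_ socle1] := I_gor.
have [b [_ b_basis0]] := I_mult.
have b_basis v : exists! a : 'rV[k]_e, v - \sum_(i < e) a 0 i *: b i \in I.
  exact: b_basis0.
(* The inclusion of [R] in its fraction field is evaluation at the generic point; no nonzero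
   polynomial vanishes there. *)
pose K : fieldType := {fraction {mpoly k[3]}}.
pose ev : {rmorphism {mpoly k[3]} -> K} := @FracField.tofrac {mpoly k[3]}.
pose iota : {rmorphism k -> K} := ev \o @mpolyC 3 k.
have ev_neq0 p : p != 0 -> ev p != 0 by rewrite tofrac_eq0.
clearbody ev.
have [B [B_unit B_sym XB B_graded]] :=
  gorenstein_pairing b_basis I_homog I_hilb h_gt_c h_c socle1.
have D_mul := degmx_mul b_basis I_homog.
have D_sum := sum_degmx b_basis I_homog I_hilb h_gt_c.
have rkD := rank_degmx b_basis I_homog I_hilb.
split.
- move=> i j ijc; rewrite -!rkD.
  exact: (rank_degmx_sym D_mul D_sum B_unit B_sym B_graded ijc).
- rewrite -(sum_rank_degmx D_mul D_sum).
  by apply: eq_bigr => i _; rewrite rkD.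
pose KD i := Kdegmx b_basis iota i.
pose L s := lform (Kvarmx b_basis iota) (fun s => ev 'X_s) s.
have KD_mul i j : KD i *m KD j = if i == j then KD i else 0.
  by rewrite -map_mxM D_mul; case: eqP => _; rewrite ?map_mx0.
have KD_sum : \sum_(i < c.+1) KD i = 1%:M.
  by rewrite -(map_mx1 iota) -D_sum raddf_sum.
pose KB := map_mx iota B.
have KB_unit : KB \in unitmx by rewrite map_unitmx.
have KB_sym : KB^T = KB by rewrite map_trmx B_sym.
have KB_graded i j : (i + j != c)%N -> KD i *m KB *m (KD j)^T = 0.
  by move=> /B_graded DBD; rewrite map_trmx -!map_mxM DBD map_mx0.
have L_deg s i : L s *m KD i.+1 = KD i *m L s.
  by apply: lform_deg => t; rewrite -!map_mxM varmx_degmx.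
have LB s : L s *m KB = KB *m (L s)^T.
  by apply: lform_pairing => t; rewrite map_trmx -!map_mxM XB.
have rkKD i : \rank (KD i) = h i by rewrite mxrank_map rkD.
exists (fun i => \rank (KD i *m L 1)); split=> [i j ijc | i di].
  exact: (rank_form_sym KD_mul KD_sum KB_unit KB_sym KB_graded (L_deg 1) (LB 1)).
rewrite -!rkKD /=.  apply: (coker_form_noninc (L_deg 1) (L_deg 2%:R)).
  by apply: lform_comm; exact: Kvarmx_comm.
have X0 : ev 'X_ord0 != 0.
  by apply: ev_neq0; rewrite -msupp_eq0 msuppX.
have evC a : ev a%:MP = iota a by [].
apply: submx_trans (generic_generation b_basis I_homog evC X0 If hf _ di) _.
  exact: ev_neq0.
(* The form of index 0 is zero, so only the two forms [L 1] and [L 2%:R] remain. *)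
apply/sumsmx_subP => -[[|[|[|//]]] s3] _.
- by rewrite (_ : Ordinal s3 = ord0) ?lform0 ?mulmx0 ?sub0mx //; apply: val_inj.
- by rewrite (_ : Ordinal s3 = 1) ?addsmxSl //; apply: val_inj.
- by rewrite (_ : Ordinal s3 = 2%:R) ?addsmxSr //; apply: val_inj.
Qed.

End GorensteinRanks.

(** * Differences of the Hilbert function *)

Definition Delta1 (h : nat -> nat) (t : int) : int := hext h t - hext h (t - 1).

Definition Delta2 (h : nat -> nat) (t : int) : int :=
  hext h t - 2 * hext h (t - 1) + hext h (t - 2).

Lemma hext_neg h (t : int) : t < 0 -> hext h t = 0.
Proof. by case: t. Qed.

Lemma Delta1S h t : Delta1 h (Posz t.+1) = (h t.+1)%:Z - (h t)%:Z.
Proof. by rewrite /Delta1 (_ : Posz t.+1 - 1 = Posz t) //; lia. Qed.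

Lemma Delta2SS h t : Delta2 h (Posz t.+2) = (h t.+2)%:Z - 2 * (h t.+1)%:Z + (h t)%:Z.
Proof.
rewrite /Delta2 (_ : Posz t.+2 - 1 = Posz t.+1); last by lia.
by rewrite (_ : Posz t.+2 - 2 = Posz t) //; lia.
Qed.

Lemma Delta2_Delta1 h t : Delta2 h t = Delta1 h t - Delta1 h (t - 1).
Proof. by rewrite /Delta2 /Delta1 (_ : t - 1 - 1 = t - 2); [ring | lia]. Qed.

Lemma Delta3_Delta2 h t : Delta3 h t = Delta2 h t - Delta2 h (t - 1).
Proof.
rewrite /Delta3 /Delta2 (_ : t - 1 - 1 = t - 2); last by lia.
by rewrite (_ : t - 1 - 2 = t - 3); [ring | lia].
Qed.

(** * Summation by parts and symmetry of the differences *)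

Section FiniteSupport.

Variables (h : nat -> nat) (c : nat).
Hypothesis h_gt_c : forall t : nat, (c < t)%N -> h t = 0%N.

Lemma hext_gt (t : int) : c%:Z < t -> hext h t = 0.
Proof. by case: t => //= t ct; rewrite h_gt_c. Qed.

Lemma sum_hext_shift N j (w : int -> int) : (c + j < N)%N ->
  \sum_(t < N) hext h (t%:Z - j%:Z) * w t%:Z =
  \sum_(t < c.+1) (h t)%:Z * w (t%:Z + j%:Z).
Proof.
move=> cjN; have -> : N = (j + (c.+1 + (N - (j + c.+1))))%N by lia.
rewrite big_split_ord /= big1 ?add0r => [|i _]; last first.
  by rewrite hext_neg ?mul0r //; have := ltn_ord i; lia.
rewrite big_split_ord /= [X in _ + X]big1 ?addr0 => [|i _]; last first.
  by rewrite hext_gt ?mul0r //; lia.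
apply: eq_bigr => i _.
rewrite (_ : Posz (j + i) - j%:Z = i); last by lia.
by rewrite (_ : Posz (j + i) = i%:Z + j%:Z) //; lia.
Qed.

(** Summation by parts: the range covers the whole support of the difference, which ends at [c + 1],
    so no boundary terms arise. Each further difference extends the range by one. *)
Lemma sum_Delta1 (w : int -> int) :
  \sum_(t < c.+2) Delta1 h t%:Z * w t%:Z =
  \sum_(t < c.+1) (h t)%:Z * (w t%:Z - w (t%:Z + 1)).
Proof.
transitivity (\sum_(t < c.+2) (hext h (t%:Z - 0%:Z) * w t%:Z
    - hext h (t%:Z - 1%:Z) * w t%:Z)).
  by apply: eq_bigr => t _; rewrite subr0 /Delta1; ring.
rewrite sumrB !sum_hext_shift; try lia.
by rewrite -sumrB; apply: eq_bigr => t _; rewrite addr0; ring.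
Qed.

Lemma sum_Delta2 (w : int -> int) :
  \sum_(t < c.+3) Delta2 h t%:Z * w t%:Z =
  \sum_(t < c.+1) (h t)%:Z * (w t%:Z - 2 * w (t%:Z + 1) + w (t%:Z + 2)).
Proof.
transitivity (\sum_(t < c.+3) (hext h (t%:Z - 0%:Z) * w t%:Z
    - 2 * (hext h (t%:Z - 1%:Z) * w t%:Z) + hext h (t%:Z - 2%:Z) * w t%:Z)).
  by apply: eq_bigr => t _; rewrite subr0 /Delta2; ring.
rewrite big_split sumrB -mulr_sumr !sum_hext_shift; try lia.
rewrite mulr_sumr -sumrB -big_split; apply: eq_bigr => t _ /=.
by rewrite addr0; ring.
Qed.

Lemma sum_Delta3 (w : int -> int) :
  \sum_(t < c.+4) Delta3 h t%:Z * w t%:Z =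
  \sum_(t < c.+1) (h t)%:Z *
    (w t%:Z - 3 * w (t%:Z + 1) + 3 * w (t%:Z + 2) - w (t%:Z + 3)).
Proof.
transitivity (\sum_(t < c.+4) (hext h (t%:Z - 0%:Z) * w t%:Z
    - 3 * (hext h (t%:Z - 1%:Z) * w t%:Z) + 3 * (hext h (t%:Z - 2%:Z) * w t%:Z)
    - hext h (t%:Z - 3%:Z) * w t%:Z)).
  by apply: eq_bigr => t _; rewrite subr0 /Delta3; ring.
rewrite sumrB big_split sumrB -!mulr_sumr !sum_hext_shift; try lia.
rewrite !mulr_sumr -sumrB -big_split -sumrB; apply: eq_bigr => t _ /=.
by rewrite addr0; ring.
Qed.

Hypothesis h_sym : forall i j, (i + j = c)%N -> h i = h j.

Lemma hext_sym (t : int) : hext h (c%:Z - t) = hext h t.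
Proof.
have [t_neg | t_ge0] := ltP t 0; first by rewrite (hext_neg h t_neg) hext_gt //; lia.
have [t_gt | t_le] := ltP c%:Z t; first by rewrite (hext_gt t_gt) hext_neg //; lia.
case: t t_ge0 t_le => // t _ t_le.
rewrite (_ : c%:Z - t%:Z = Posz (c - t)); last by lia.
by congr Posz; apply: h_sym; lia.
Qed.

Lemma Delta1_sym t : Delta1 h (c%:Z + 1 - t) = - Delta1 h t.
Proof.
rewrite /Delta1 -(hext_sym t) -(hext_sym (t - 1)).
rewrite (_ : c%:Z + 1 - t - 1 = c%:Z - t); last by lia.
by rewrite (_ : c%:Z - (t - 1) = c%:Z + 1 - t); [ring | lia].
Qed.

Lemma Delta2_sym t : Delta2 h (c%:Z + 2 - t) = Delta2 h t.
Proof.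
rewrite !Delta2_Delta1 (_ : c%:Z + 2 - t = c%:Z + 1 - (t - 1)); last by lia.
rewrite Delta1_sym (_ : c%:Z + 1 - (t - 1) - 1 = c%:Z + 1 - t); last by lia.
by rewrite Delta1_sym; ring.
Qed.

Lemma Delta3_sym t : Delta3 h (c%:Z + 3 - t) = - Delta3 h t.
Proof.
rewrite !Delta3_Delta2 (_ : c%:Z + 3 - t = c%:Z + 2 - (t - 1)); last by lia.
rewrite Delta2_sym (_ : c%:Z + 2 - (t - 1) - 1 = c%:Z + 2 - t); last by lia.
by rewrite Delta2_sym; ring.
Qed.

End FiniteSupport.

(** * Closed forms for sums, and a chord inequality *)

Lemma sum_fold_sym (N q : nat) (F : nat -> int) : (q + q <= N)%N ->
    (forall i, (i < q)%N -> F (N - i.+1)%N = F i) ->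
  \sum_(t < N) F t = 2 * (\sum_(t < q) F t) + \sum_(i < N - (q + q)) F (q + i)%N.
Proof.
move=> qN F_sym; have NE : (q + (N - (q + q) + q) = N)%N by lia.
have -> : \sum_(t < N) F t = \sum_(t < q + (N - (q + q) + q)) F t by rewrite NE.
rewrite !big_split_ord /=.
have -> : \sum_(i < q) F (q + (N - (q + q) + i))%N = \sum_(i < q) F i.
  rewrite (reindex_inj rev_ord_inj) /=; apply: eq_bigr => i _.
  rewrite -[RHS]F_sym //=; congr (F _); have := ltn_ord i; lia.
by rewrite [X in _ + X]addrC addrA; congr (_ + _); ring.
Qed.

(** Evaluates the degrees where the first difference is [t + 1]. [sum_descent] does the same along a
    descending chord, and [sum_squares] where the second difference is 1; the factors 6 and 3 clear
    denominators. *)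
Lemma sum_ascent (a : nat) (C : int) :
  6 * (\sum_(t < a) (t%:Z + 1) * (C - 2 * t%:Z)) =
  a%:Z * (a%:Z + 1) * (3 * C - 4 * (a%:Z - 1)).
Proof.
elim: a => [|a IHa]; first by rewrite big_ord0; ring.
by rewrite big_ord_recr mulrDr IHa /= (_ : Posz a.+1 = a%:Z + 1); [ring | lia].
Qed.

Lemma sum_descent (m : nat) (M C : int) :
  6 * (\sum_(i < m) (M - 1 - i%:Z) * (C - 2 * i%:Z)) =
  C * (6 * m%:Z * (M - 1) - 3 * m%:Z * (m%:Z - 1)) -
  2 * (3 * (M - 1) * m%:Z * (m%:Z - 1) - (m%:Z - 1) * m%:Z * (2 * m%:Z - 1)).
Proof.
elim: m => [|m IHm]; first by rewrite big_ord0; ring.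
by rewrite big_ord_recr mulrDr IHm /= (_ : Posz m.+1 = m%:Z + 1); [ring | lia].
Qed.

Lemma sum_squares (a : nat) (C : int) :
  3 * (\sum_(t < a) (C - 2 * t%:Z) ^+ 2) =
  3 * a%:Z * C ^+ 2 - 6 * C * a%:Z * (a%:Z - 1)
    + 2 * a%:Z * (a%:Z - 1) * (2 * a%:Z - 1).
Proof.
elim: a => [|a IHa]; first by rewrite big_ord0; ring.
by rewrite big_ord_recr mulrDr IHa /= (_ : Posz a.+1 = a%:Z + 1); [ring | lia].
Qed.

(** Concavity keeps [D] above the chord from [(a, D a)] to [(b, 0)]; denominators are cleared. *)
Lemma concave_chord (D : nat -> int) (a b t : nat) :
    (forall i, (a < i)%N -> (i < b)%N -> D i.+1 - D i <= D i - D i.-1) ->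
    0 <= D b -> (a <= t)%N -> (t <= b)%N ->
  (b%:Z - t%:Z) * D a <= (b%:Z - a%:Z) * D t.
Proof.
move=> D_conc Db; elim: t => [|t IHt] at_ tb.
  by rewrite (_ : a = 0%N) //; lia.
have [at1 | at1] := ltnP t a; first by rewrite (_ : a = t.+1) //; lia.
(* Later increments never exceed the one from [t] to [t + 1]. If [D] fell too fast there, it would
   be negative at [b]. *)
have incr m : (t.+1 + m <= b)%N -> D (t.+1 + m)%N <= D t.+1 + m%:Z * (D t.+1 - D t)
    /\ ((0 < m)%N -> D (t.+1 + m)%N - D (t.+1 + m).-1 <= D t.+1 - D t).
  elim: m => [|m IHm] tm; first by rewrite addn0; split=> //; lia.
  have [H1 H2] := IHm ltac:(lia).
  have step : D (t.+1 + m.+1)%N - D (t.+1 + m)%N <= D t.+1 - D t.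
    case: (posnP m) => [m0 | m_gt0].
      rewrite m0 addn0 addn1; apply: D_conc; lia.
    apply: le_trans (H2 m_gt0); rewrite addnS; apply: D_conc; lia.
  by rewrite addnS /= -addnS; split=> [|_ //]; lia.
have [] := incr (b - t.+1)%N ltac:(lia).
rewrite (_ : (t.+1 + (b - t.+1) = b)%N); last by lia.
rewrite (_ : (b - t.+1)%:Z = b%:Z - t%:Z - 1); last by lia.
move=> Dbt _; have {IHt} := IHt at1 (ltnW tb).
rewrite (_ : Posz t.+1 = t%:Z + 1); last by lia.
have : 0 < b%:Z - t%:Z by lia.
have : 0 <= b%:Z - a%:Z by lia.
move: (D a) (D t) (D t.+1) (D b) Db Dbt => Da Dt Dt1 Db0 Db Dbt ba bt IH.
rewrite -(ler_pM2l bt).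
have H1 : (b%:Z - t%:Z - 1) * ((b%:Z - t%:Z) * Da) <=
  (b%:Z - t%:Z - 1) * ((b%:Z - a%:Z) * Dt) by apply: ler_wpM2l; lia.
have H2 : (b%:Z - a%:Z) * ((b%:Z - t%:Z - 1) * Dt) <=
  (b%:Z - a%:Z) * ((b%:Z - t%:Z) * Dt1) by apply: ler_wpM2l; lia.
lia.
Qed.

(** * Numerical consequences: shape of the Hilbert function and bounds on the multiplicity *)

Section Gorenstein3Hilbert.

Variables (h : nat -> nat) (c d : nat) (r : nat -> nat).
Hypothesis h_gt_c : forall t : nat, (c < t)%N -> h t = 0%N.
Hypothesis h_sym : forall i j, (i + j = c)%N -> h i = h j.
Hypothesis d_gt1 : (1 < d)%N.
Hypothesis h_small : forall t, (t < d)%N -> h t = 'C(t + 2, 2).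
Hypothesis r_sym : forall i j, (i + j.+1 = c)%N -> r i = r j.
Hypothesis r_coker : forall i, (d <= i.+2)%N -> (h i.+2 + r i <= h i.+1 + r i.+1)%N.

Lemma bin2S t : 'C(t.+1 + 2, 2) = ('C(t + 2, 2) + t.+2)%N.
Proof. by rewrite addSn binS bin1 addn2. Qed.

Lemma Delta1_small t : (t < d)%N -> Delta1 h t%:Z = t%:Z + 1.
Proof.
case: t => [|t] td; first by rewrite /Delta1 /= h_small.
by rewrite Delta1S !h_small ?bin2S; lia.
Qed.

Lemma Delta2_small t : (t < d)%N -> Delta2 h t%:Z = 1.
Proof.
case: t => [|t] td; first by rewrite /Delta2 /= h_small.
rewrite Delta2_Delta1 (_ : Posz t.+1 - 1 = t%:Z); last by lia.
by rewrite !Delta1_small; lia.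
Qed.

(** Otherwise [c - (d - 1) < d - 1], where [h] is still strictly increasing, yet symmetry gives
    equal values at these two degrees. If [c < d - 1], the positive value at [d - 1] contradicts
    vanishing beyond [c]. *)
Lemma order_le : (d + d <= c + 2)%N.
Proof.
rewrite leqNgt; apply/negP => cd.
have lt_bin i j : (i < j)%N -> ('C(i + 2, 2) < 'C(j + 2, 2))%N.
  elim: j => // j IHj; rewrite ltnS leq_eqVlt bin2S => /orP[/eqP -> | /IHj]; lia.
have hd1 : h d.-1 = 'C(d.-1 + 2, 2) by apply: h_small; lia.
have [dc | dc] := ltnP c d.-1.
  by have := lt_bin 0%N d.-1; rewrite -hd1 h_gt_c //; lia.
have hcd : h (c - d.-1)%N = 'C(c - d.-1 + 2, 2) by apply: h_small; lia.
have : (h (c - d.-1) < h d.-1)%N by rewrite hcd hd1; apply: lt_bin; lia.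
by rewrite (@h_sym (c - d.-1) d.-1) ?ltnn //; lia.
Qed.

Lemma Delta2_nonpos t : (d <= t)%N -> (t + d <= c + 2)%N -> Delta2 h t%:Z <= 0.
Proof.
move=> dt tdc; have t2 : (1 < t)%N by apply: leq_trans dt.
case: t t2 dt tdc => [|[|i]] // _ dt tdc; rewrite Delta2SS.
have := r_coker dt.
(* The mirror inequality is the one at index [c - t] with [t = i + 2]; symmetry exchanges the two
   ranks, which cancel in the sum. *)
have dc : (d <= (c - i.+2).+2)%N by lia.
have := r_coker dc.
rewrite (@h_sym (c - i.+2).+2 i); last by lia.
rewrite (@h_sym (c - i.+2).+1 i.+1); last by lia.
rewrite (@r_sym (c - i.+2) i.+1); last by lia.
rewrite (@r_sym (c - i.+2).+1 i); last by lia.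
lia.
Qed.

(** From degree [d] on, the first difference does not increase between [t] and the mirror degree
    [c + 1 - t], where it takes the opposite value. *)
Lemma Delta1_ge0 t : (t + t <= c + 1)%N -> 0 <= Delta1 h t%:Z.
Proof.
move=> tc; have [td | dt] := ltnP t d; first by rewrite Delta1_small //; lia.
have noninc m : (t + m + d <= c + 2)%N -> Delta1 h (t + m)%:Z <= Delta1 h t%:Z.
  elim: m => [|m IHm] tmd; first by rewrite addn0.
  have /IHm : (t + m + d <= c + 2)%N by lia.
  have : Delta2 h (t + m.+1)%:Z <= 0 by apply: Delta2_nonpos; lia.
  by rewrite Delta2_Delta1 (_ : (t + m.+1)%:Z - 1 = (t + m)%:Z); lia.
have := noninc (c + 1 - t - t)%N.
rewrite (_ : (t + (c + 1 - t - t))%:Z = c%:Z + 1 - t%:Z); last by lia.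
by rewrite Delta1_sym //; lia.
Qed.

Lemma Delta3_order : Delta3 h d%:Z < 0.
Proof.
have := Delta2_nonpos (leqnn d) order_le.
rewrite Delta3_Delta2 (_ : d%:Z - 1 = (d.-1)%:Z); last by lia.
by rewrite (@Delta2_small d.-1); lia.
Qed.

Lemma Delta3_small (t : int) : 0 < t < d%:Z -> Delta3 h t = 0.
Proof.
case: t => [[|t]|t] // td; rewrite Delta3_Delta2.
by rewrite (_ : Posz t.+1 - 1 = t%:Z) ?Delta2_small //; lia.
Qed.

Lemma Delta3_0 : Delta3 h 0 = 1.
Proof. by rewrite /Delta3 /= h_small // ltnW. Qed.

Variable n2 : int.
Hypothesis n2_def : is_min (fun t => 0 < t /\ 0 < Delta3 h t) n2.

Lemma order_lt_n2 : d%:Z < n2.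
Proof.
have [[n2_gt0 n2_pos] _] := n2_def.
have [//|n2d] := ltP d%:Z n2; have [n2_eq | n2_neq] := eqVneq n2 d%:Z.
  by have := Delta3_order; rewrite -n2_eq; lia.
by rewrite Delta3_small // in n2_pos; lia.
Qed.

Lemma Delta3_nonpos (t : int) : 0 < t < n2 -> Delta3 h t <= 0.
Proof.
have [_ n2_min] := n2_def; move=> /andP[t_gt0 tn2].
by rewrite leNgt; apply/negP => t_pos; have := n2_min t (conj t_gt0 t_pos); lia.
Qed.

Lemma weight_nonneg (t : int) : c%:Z + 3 <= 2 * n2 -> 0 < t < c%:Z + 3 ->
  0 <= - Delta3 h t * (c%:Z + 3 - 2 * t).
Proof.
move=> cn2 /andP[t_gt0 tc].
have [lt | gt | eq] := ltrgtP (2 * t) (c%:Z + 3).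
- have : Delta3 h t <= 0 by apply: Delta3_nonpos; lia.
  nia.
- have : Delta3 h (c%:Z + 3 - t) <= 0 by apply: Delta3_nonpos; lia.
  by rewrite (Delta3_sym h_gt_c h_sym); nia.
- by rewrite eq subrr mulr0.
Qed.

(** A negative value at [t] reflects to a positive one at [c + 3 - t], which is therefore at least
    [n2]. The vanishing in positive degrees below [d] reflects in the same way. *)
Lemma Delta3_support (t : int) : 0 < t < c%:Z + 3 -> Delta3 h t != 0 ->
  (d%:Z <= t <= c%:Z + 3 - n2) || (n2 <= t <= c%:Z + 3 - d%:Z).
Proof.
have [_ n2_min] := n2_def; have dn2 := order_lt_n2.
move=> /andP[t_gt0 tc] t_neq0.
have td : d%:Z <= t.
  by rewrite leNgt; apply/negP => td; rewrite Delta3_small ?eqxx ?t_gt0 in t_neq0.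
have ts : t <= c%:Z + 3 - d%:Z.
  rewrite leNgt; apply/negP => td'; move: t_neq0.
  by rewrite -[Delta3 h t]opprK -(Delta3_sym h_gt_c h_sym) Delta3_small //; lia.
have [lt | gt | eq] := ltrgtP (Delta3 h t) 0; last by rewrite eq eqxx in t_neq0.
- have := n2_min (c%:Z + 3 - t).
  by rewrite (Delta3_sym h_gt_c h_sym) => /(_ ltac:(lia)); lia.
- by have := n2_min t (conj t_gt0 gt); lia.
Qed.

Variable e : nat.
Hypothesis e_sum : e = (\sum_(t < c.+1) h t)%N.

Lemma e_sumZ (a : int) : \sum_(t < c.+1) (h t)%:Z * a = a * e%:Z.
Proof.
rewrite e_sum (big_morph Posz PoszD (erefl _)) mulr_sumr.
by apply: eq_bigr => t _; rewrite mulrC.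
Qed.

Lemma weighted_sum (A : int) :
  \sum_(i < c.+2) - Delta3 h i.+1%:Z *
    ((c%:Z + 3 - 2 * i.+1%:Z) * (i.+1%:Z * (c%:Z + 3 - i.+1%:Z) - A)) =
  12 * e%:Z - 2 * (c%:Z + 3) * A.
Proof.
pose w t : int := (c%:Z + 3 - 2 * t) * (t * (c%:Z + 3 - t) - A).
(* [w] is a cubic with leading term [2 * t ^ 3]; the alternating sum is minus its third
   difference. *)
have w3 t : w t - 3 * w (t + 1) + 3 * w (t + 2) - w (t + 3) = - 12.
  by rewrite /w; ring.
have := sum_Delta3 h_gt_c w; under [in RHS]eq_bigr => t _ do rewrite w3.
(* The end terms [t = 0] and [t = c + 3], where the third difference is 1 and -1, are split off;
   they contribute the multiple of [A]. *)
rewrite e_sumZ big_ord_recl big_ord_recr /= Delta3_0.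
rewrite (_ : Delta3 h _ = - 1); last first.
  rewrite -Delta3_0 -(Delta3_sym h_gt_c h_sym); congr Delta3.
  by rewrite /bump /=; lia.
set S1 := \sum_(i < _) _; set S2 := \sum_(i < _) _.
have -> : S2 = - S1 by rewrite -sumrN; apply: eq_bigr => i _; rewrite mulNr.
have -> : w (1 + c.+2)%N = (c%:Z + 3) * A.
  by rewrite /w (_ : (1 + c.+2)%:Z = c%:Z + 3) /bump; [ring | lia].
have -> : w 0 = - (c%:Z + 3) * A by rewrite /w; ring.
lia.
Qed.

Let s : int := c%:Z + 3.

(** With this [A] the weighted sum is zero while its terms, multiplied by [g], are nonnegative, so
    each vanishes. At [t = d] neither the third difference nor [s - 2 * d] is zero. The sign [g] is
    1 for the lower bound and -1 for the upper one. *)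
Lemma convex_rigidity (g A : int) : s <= 2 * n2 -> 6 * e%:Z = A * s -> g != 0 ->
    (forall t, (d%:Z <= t <= s - n2) || (n2 <= t <= s - d%:Z) ->
      0 <= g * (t * (s - t) - A)) ->
  d%:Z * (s - d%:Z) = A.
Proof.
move=> sn2 e6 g_neq0 gA; have d_le := order_le; have d_neg := Delta3_order.
pose F t : int := - Delta3 h t * ((s - 2 * t) * (t * (s - t) - A)).
have F_ge0 (i : 'I_c.+2) : true -> 0 <= g * F i.+1%:Z.
  move=> _; have ti : 0 < i.+1%:Z < s by have := ltn_ord i; rewrite /s; lia.
  rewrite /F; have [-> | nz] := eqVneq (Delta3 h i.+1%:Z) 0.
    by rewrite oppr0 mul0r mulr0.
  rewrite [- _ * (_ * _)]mulrA mulrCA mulr_ge0 ?weight_nonneg //.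
  by apply: gA; exact: Delta3_support.
have F_sum : \sum_(i < c.+2) g * F i.+1%:Z = 0.
  have e12 : 12 * e%:Z = 2 * (A * s) by rewrite -e6; ring.
  by rewrite -mulr_sumr weighted_sum e12 /s; ring.
have d1 : (d.-1 < c.+2)%N by lia.
have := psumr_eq0P F_ge0 F_sum (i := Ordinal d1) isT.
rewrite /= (_ : d.-1.+1 = d); last by lia.
move/eqP; rewrite !mulf_eq0 oppr_eq0 (negPf g_neq0) (lt_eqF d_neg) /=.
by case/orP => /eqP; rewrite /s; lia.
Qed.

Lemma mult_lower_convex : s <= 2 * n2 -> 6 * e%:Z = d%:Z * n2 * s -> d%:Z + n2 = s.
Proof.
move=> sn2 e6; have dn2 := order_lt_n2.
have := convex_rigidity (g := 1) sn2 e6 isT; rewrite -/s => H.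
have {H} H : d%:Z * (s - d%:Z) = d%:Z * n2.
  by apply: H => t; rewrite mul1r; case/orP => /andP[lo hi]; nia.
by have := mulfI (_ : d%:Z != 0) H; lia.
Qed.

Lemma mult_upper_convex : s <= 2 * n2 ->
  6 * e%:Z = (s - n2) * (s - d%:Z) * s -> d%:Z + n2 = s.
Proof.
move=> sn2 e6; have dn2 := order_lt_n2; have d_le := order_le.
have := convex_rigidity (g := -1) sn2 e6 isT; rewrite -/s => H.
have {H} H : d%:Z * (s - d%:Z) = (s - n2) * (s - d%:Z).
  by apply: H => t; case/orP => /andP[lo hi]; nia.
by have := mulIf (_ : s - d%:Z != 0) H; rewrite /s; lia.
Qed.

(** The support reduces to [d] and [n2], where [t * (s - t)] equals [d * n2], so every term of
    [weighted_sum] is zero. *)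
Lemma mult_pure : d%:Z + n2 = s -> 6 * e%:Z = d%:Z * n2 * s.
Proof.
move=> dn2s; have := weighted_sum (d%:Z * n2).
rewrite big1 => [|i _]; first by rewrite -/s; lia.
have [-> | nz] := eqVneq (Delta3 h i.+1%:Z) 0; first by rewrite oppr0 mul0r.
have i_s : 0 < i.+1%:Z < c%:Z + 3 by have := ltn_ord i; lia.
have := Delta3_support i_s nz; rewrite -/s.
have -> : s - n2 = d%:Z by lia.
have -> : s - d%:Z = n2 by lia.
by rewrite -!eq_le => /orP[] /eqP <-; rewrite -dn2s; ring.
Qed.

(** Folding the first-difference formula for [2 * e] bounds [e] below by its terms in degrees under
    [n2]. There the first difference is [t + 1] up to [d - 1], then concave, hence above the chord
    falling to 0 at [n2 - 1]. This gives [6 * e >= d * n2 * (3 * s - 2 * d - 2 * n2)], and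
    [d + n2 < s]. *)
Lemma mult_lower_concave : 2 * n2 < s -> d%:Z * n2 * s < 6 * e%:Z.
Proof.
move=> n2s; have dn2 := order_lt_n2.
have [q n2q] : exists q : nat, n2 = q%:Z by exists `|n2|%N; lia.
have dq : (d < q)%N by lia.
pose F t : int := Delta1 h t%:Z * (c%:Z + 1 - 2 * t%:Z).
have F_ge0 t : (t <= c + 1)%N -> 0 <= F t.
  move=> tc; rewrite /F; have [tc2 | tc2] := leqP (t + t) (c + 1).
    by have := Delta1_ge0 tc2; nia.
  have : (c + 1 - t + (c + 1 - t) <= c + 1)%N by lia.
  move/Delta1_ge0; rewrite (_ : (c + 1 - t)%:Z = c%:Z + 1 - t%:Z); last by lia.
  by rewrite Delta1_sym //; nia.
have e2 : 2 * e%:Z = \sum_(t < c.+2) F t.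
  pose w (t : int) : int := c%:Z + 1 - 2 * t.
  rewrite (sum_Delta1 h_gt_c w) -e_sumZ.
  by apply: eq_bigr => t _; rewrite /w; ring.
have e_ge : \sum_(t < q) F t <= e%:Z.
  rewrite (@sum_fold_sym _ q) in e2; first last.
  - move=> i iq; rewrite /F (_ : (c.+2 - i.+1)%:Z = c%:Z + 1 - i%:Z); last by lia.
    by rewrite Delta1_sym //; ring.
  - by lia.
  have : 0 <= \sum_(i < c.+2 - (q + q)) F (q + i)%N.
    by apply: sumr_ge0 => i _; apply: F_ge0; have := ltn_ord i; lia.
  lia.
have chord t : (d.-1 <= t)%N -> (t < q)%N ->
    d%:Z * (q%:Z - 1 - t%:Z) <= (q%:Z - d%:Z) * Delta1 h t%:Z.
  move=> dt tq; pose D (i : nat) := Delta1 h i%:Z.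
  have := @concave_chord D d.-1 q.-1 t.
  rewrite /D (@Delta1_small d.-1); last by lia.
  rewrite (_ : d.-1%:Z + 1 = d%:Z); last by lia.
  rewrite (_ : q.-1%:Z - t%:Z = q%:Z - 1 - t%:Z); last by lia.
  rewrite (_ : q.-1%:Z - d.-1%:Z = q%:Z - d%:Z); last by lia.
  rewrite (mulrC (q%:Z - 1 - t%:Z)); apply; try lia; last first.
    by apply: Delta1_ge0; lia.
  move=> i di iq; have : Delta3 h i.+1%:Z <= 0.
    by apply: Delta3_nonpos; rewrite n2q; lia.
  rewrite Delta3_Delta2 !Delta2_Delta1.
  rewrite (_ : i.+1%:Z - 1 = i%:Z); last by lia.
  by rewrite (_ : i%:Z - 1 = i.-1%:Z); lia.
have low : (q%:Z - d%:Z) * (\sum_(t < d) (t%:Z + 1) * (c%:Z + 1 - 2 * t%:Z)) +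
    d%:Z * (\sum_(i < q - d) (q%:Z - d%:Z - 1 - i%:Z) * (c%:Z + 1 - 2 * d%:Z - 2 * i%:Z))
    <= (q%:Z - d%:Z) * e%:Z.
  apply: le_trans (ler_wpM2l (_ : 0 <= q%:Z - d%:Z) e_ge); last by lia.
  have -> : \sum_(t < q) F t = \sum_(t < d + (q - d)) F t by rewrite subnKC // ltnW.
  rewrite big_split_ord mulrDr lerD //= !mulr_sumr ler_sum // => i _.
    by rewrite /F Delta1_small.
  have := chord (d + i)%N ltac:(lia) ltac:(have := ltn_ord i; lia).
  have : 0 <= c%:Z + 1 - 2 * (d + i)%:Z by have := ltn_ord i; lia.
  rewrite /F PoszD => ? ?; rewrite !mulrA.
  have -> : c%:Z + 1 - 2 * d%:Z - 2 * i%:Z = c%:Z + 1 - 2 * (d%:Z + i%:Z) by ring.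
  by apply: ler_wpM2r => //; lia.
have := sum_ascent d (c%:Z + 1); set S1 := \sum_(t < d) _ in low *.
have := sum_descent (q - d) (q%:Z - d%:Z) (c%:Z + 1 - 2 * d%:Z).
set S2 := \sum_(i < q - d) _ in low *.
have -> : (q - d)%:Z = q%:Z - d%:Z by lia.
move=> desc asc.
have : (q%:Z - d%:Z) * (d%:Z * q%:Z * (3 * s - 2 * d%:Z - 2 * q%:Z)) <=
    (q%:Z - d%:Z) * (6 * e%:Z).
  have -> : (q%:Z - d%:Z) * (6 * e%:Z) = 6 * ((q%:Z - d%:Z) * e%:Z) by ring.
  apply: le_trans (ler_wpM2l (_ : 0 <= 6 :> int) low) => //.
  have -> : 6 * ((q%:Z - d%:Z) * S1 + d%:Z * S2) =
    (q%:Z - d%:Z) * (6 * S1) + d%:Z * (6 * S2) by ring.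
  rewrite asc desc /s.
  by rewrite le_eqVlt; apply/orP; left; apply/eqP; ring.
rewrite ler_pM2l; last by lia.
apply: lt_le_trans; rewrite n2q ltr_pM2l ?mulr_gt0 //; lia.
Qed.

(** The square weight has second difference 8, so it computes [8 * e]. Dropping the nonpositive
    middle terms leaves twice a sum of [d] squares, whence [12 * e < s ^ 2 * (s - d)]; finally
    [s < 2 * (s - n2)]. *)
Lemma mult_upper_concave : 2 * n2 < s -> 6 * e%:Z < (s - n2) * (s - d%:Z) * s.
Proof.
move=> n2s; have dn2 := order_lt_n2; have d_le := order_le.
pose F t : int := Delta2 h t%:Z * (c%:Z + 2 - 2 * t%:Z) ^+ 2.
have e8 : 8 * e%:Z = \sum_(t < c.+3) F t.
  pose w (t : int) : int := (c%:Z + 2 - 2 * t) ^+ 2.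
  rewrite (sum_Delta2 h_gt_c w) -e_sumZ.
  by apply: eq_bigr => t _; rewrite /w; ring.
rewrite (@sum_fold_sym _ d) in e8; first last.
- move=> i iq; rewrite /F (_ : (c.+3 - i.+1)%:Z = c%:Z + 2 - i%:Z); last by lia.
  by rewrite Delta2_sym //; ring.
- by lia.
have mid : \sum_(i < c.+3 - (d + d)) F (d + i)%N <= 0.
  rewrite -oppr_ge0 -sumrN; apply: sumr_ge0 => i _; rewrite -mulNr.
  rewrite mulr_ge0 ?sqr_ge0 // oppr_ge0; apply: Delta2_nonpos; first exact: leq_addr.
  by have := ltn_ord i; lia.
have ends : \sum_(t < d) F t = \sum_(t < d) (c%:Z + 2 - 2 * t%:Z) ^+ 2.
  by apply: eq_bigr => t _; rewrite /F Delta2_small ?mul1r.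
have := sum_squares d (c%:Z + 2); rewrite -ends => sq.
have e24 : 12 * e%:Z <= 3 * (\sum_(t < d) F t) by lia.
have half : s * (s - d%:Z) * s < 2 * ((s - n2) * (s - d%:Z) * s).
  have pos : 0 < (s - d%:Z) * s * (s - 2 * n2).
    by rewrite /s in n2s *; rewrite !mulr_gt0 //; lia.
  have E : 2 * ((s - n2) * (s - d%:Z) * s) - s * (s - d%:Z) * s =
    (s - d%:Z) * s * (s - 2 * n2) by ring.
  by rewrite -subr_gt0 E.
have cubic : 3 * (\sum_(t < d) F t) < s * (s - d%:Z) * s.
  rewrite sq -subr_gt0.
  have -> : s * (s - d%:Z) * s - (3 * d%:Z * (c%:Z + 2) ^+ 2
      - 6 * (c%:Z + 2) * d%:Z * (d%:Z - 1) + 2 * d%:Z * (d%:Z - 1) * (2 * d%:Z - 1)) =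
    (s - 2 * d%:Z) * ((s - d%:Z) ^+ 2 + d%:Z ^+ 2) + d%:Z by rewrite /s; ring.
  apply: ltr_wpDl; last by lia.
  by apply: mulr_ge0; [rewrite /s; lia | rewrite addr_ge0 ?sqr_ge0].
lia.
Qed.

Lemma mult_lower_eq : 6 * e%:Z = d%:Z * n2 * s <-> d%:Z + n2 = s.
Proof.
split=> [e6 |]; last exact: mult_pure.
have [lt | ge] := ltP (2 * n2) s; last exact: mult_lower_convex.
by have := mult_lower_concave lt; rewrite e6 ltxx.
Qed.

Lemma mult_upper_eq : 6 * e%:Z = (s - n2) * (s - d%:Z) * s <-> d%:Z + n2 = s.
Proof.
split=> [e6 | dn2s].
  have [lt | ge] := ltP (2 * n2) s; last exact: mult_upper_convex.
  by have := mult_upper_concave lt; rewrite e6 ltxx.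
by rewrite mult_pure // -dn2s; ring.
Qed.

End Gorenstein3Hilbert.

(** * Equivalence of the four conditions *)

Lemma rat_multiplicity (a b : int) (c e : nat) :
  e%:R = (3`!)%:R^-1 * a%:~R * b%:~R * (c + 3)%:R :> rat <->
  6 * e%:Z = a * b * (c%:Z + 3).
Proof.
have r6 : (6%:R : rat) != 0 by [].
have E1 : 6%:R * e%:R = (6 * e%:Z)%:~R :> rat by rewrite intrM.
have E2 : a%:~R * b%:~R * (c + 3)%:R = (a * b * (c%:Z + 3))%:~R :> rat.
  by rewrite natrD !intrM intrD.
have E3 : (3`!)%:R^-1 * a%:~R * b%:~R * (c + 3)%:R =
    6%:R^-1 * (a * b * (c%:Z + 3))%:~R :> rat by rewrite -E2 !mulrA.
rewrite E3; split=> eq.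
  by apply: (@intr_inj rat); rewrite -E1 eq (mulVKf r6).
by apply: (mulfI r6); rewrite E1 eq (mulVKf r6).
Qed.

Theorem corollary3p2 (k : fieldType) (I : idealr {mpoly k[3]})
    (h : nat -> nat) (c e : nat) (n1 n2 N1 N2 : int)
    (I_homog : homogeneous_ideal I)
    (I_gor : artinian_gorenstein_quot I)
    (I_hilb : hilbert_function I h)
    (h1 : h 1%N = 3%N)
    (h_c : h c <> 0%N)
    (h_gt_c : forall t : nat, (c < t)%N -> h t = 0%N)
    (I_mult : artinian_multiplicity I e)
    (n1_def : is_min (fun t => Delta3 h t < 0) n1)
    (n2_def : is_min (fun t => 0 < t /\ 0 < Delta3 h t) n2)
    (N1_def : is_max (fun t => t <= c%:Z + 1 /\ Delta3 h t < 0) N1)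
    (N2_def : is_max (fun t => 0 < Delta3 h t) N2) :
  [<-> e%:R = (3`!)%:R^-1 * n1%:~R * n2%:~R * (c + 3)%:R :> rat;
       e%:R = (3`!)%:R^-1 * N1%:~R * N2%:~R * (c + 3)%:R :> rat;
       n1 = N1 /\ n2 = N2;
       exists t1 t2 : int,
         [/\ unique (fun t => 1 <= t <= c%:Z + 2 /\ Delta3 h t < 0) t1,
             unique (fun t => 1 <= t <= c%:Z + 2 /\ 0 < Delta3 h t) t2,
             - Delta3 h t1 = Delta3 h t2 &
             t1 + t2 = c%:Z + 3]].
Proof.
have bin2 t : 'C(t + 2, t) = 'C(t + 2, 2) by rewrite -bin_sub ?leq_addr ?addKn.
have h_le t : (h t <= 'C(t + 2, 2))%N.
  by rewrite -bin2; exact: (hilbert_le_binomial t I_homog I_hilb I_mult).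
(* If [h 0] were 0, then 1 would belong to the proper ideal [I]. *)
have h0 : h 0%N != 0%N.
  apply/eqP => h00; have [v [_ vP]] := I_hilb 0%N.
  have [|a [Ia _]] := vP 1; first exact: dhomog1.
  rewrite big1 ?subr0 ?idealr1 // in Ia.
  by case=> i hi _; exfalso; rewrite h00 in hi.
have exd : exists t, (h t < 'C(t + 2, 2))%N.
  by exists c.+1; rewrite h_gt_c // bin_gt0 leq_addl.
(* [d] is the initial degree of [I]: the first degree in which [R / I] is smaller than [R]. *)
case: (ex_minnP exd) => d hd d_min.
have h_small t : (t < d)%N -> h t = 'C(t + 2, 2).
  move=> td; apply/eqP; rewrite eqn_leq h_le leqNgt; apply/negP => /d_min.
  by rewrite leqNgt td.
have d_gt1 : (1 < d)%N.
  by case: d hd {d_min h_small} => [|[|d]] //; rewrite ?h1 // ltnS leqn0 (negPf h0).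
have [f [If hf f0]] : exists f, [/\ f \in I, f \is d.-homog & f != 0].
  by apply: (hilbert_lt_binomial I_homog I_hilb I_mult); rewrite bin2.
have [h_sym e_sum [r [r_sym r_coker]]] :=
  gorenstein_ranks I_homog I_gor I_hilb h_c h_gt_c I_mult If hf f0.
have D3_sym := Delta3_sym h_gt_c h_sym.
have D3_small := Delta3_small d_gt1 h_small.
have D3_d := Delta3_order h_gt_c h_sym d_gt1 h_small r_sym r_coker.
(* Before degree [d] the third difference is 0, except for the value 1 in degree 0. *)
have n1E : n1 = d%:Z.
  have [n1_neg n1_min] := n1_def; apply: le_anti; rewrite (n1_min _ D3_d) /=.
  have [//|n1d] := leP d%:Z n1; have [n1_lt0 | n1_ge0] := ltP n1 0.
    by move: n1_neg; rewrite /Delta3 !hext_neg //; lia.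
  have [n1_0 | n1_neq0] := eqVneq n1 0.
    by move: n1_neg; rewrite n1_0 (Delta3_0 d_gt1 h_small).
  by rewrite D3_small // in n1_neg; lia.
have n1_gt1 : 1 < n1 by lia.
have n2_gt1 : n1 < n2.
  by rewrite n1E; exact: (order_lt_n2 h_gt_c h_sym d_gt1 h_small r_sym r_coker n2_def).
(* The bound [c + 1] in the definition of [N1] excludes the value -1 at [c + 3], just as positivity
   excludes its mirror image at 0 from [n2]. *)
have N1E : N1 = c%:Z + 3 - n2.
  have [[n2_gt0 n2_pos] n2_min] := n2_def; have [[N1_le N1_neg] N1_max] := N1_def.
  have := N1_max (c%:Z + 3 - n2); rewrite D3_sym.
  have := n2_min (c%:Z + 3 - N1); rewrite D3_sym; lia.
have N2E : N2 = c%:Z + 3 - n1.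
  have [n1_neg n1_min] := n1_def; have [N2_pos N2_max] := N2_def.
  have := N2_max (c%:Z + 3 - n1); rewrite D3_sym.
  have := n1_min (c%:Z + 3 - N2); rewrite D3_sym; lia.
have lower : 6 * e%:Z = n1 * n2 * (c%:Z + 3) <-> n1 + n2 = c%:Z + 3.
  rewrite n1E.
  exact: (mult_lower_eq h_gt_c h_sym d_gt1 h_small r_sym r_coker n2_def e_sum).
have upper : 6 * e%:Z = N1 * N2 * (c%:Z + 3) <-> n1 + n2 = c%:Z + 3.
  rewrite N1E N2E n1E.
  exact: (mult_upper_eq h_gt_c h_sym d_gt1 h_small r_sym r_coker n2_def e_sum).
tfae.
- by move/rat_multiplicity/lower/upper => E; apply/rat_multiplicity.
- by move/rat_multiplicity/upper => E; split; lia.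
- case=> n1N1 n2N2; exists n1, n2.
  have [n1_neg n1_min] := n1_def; have [[n2_gt0 n2_pos] n2_min] := n2_def.
  have [_ N1_max] := N1_def; have [_ N2_max] := N2_def.
  (* Condition (4) ranges up to [c + 2] but [N1] only up to [c + 1]; the extra degree mirrors degree
     1, where the third difference vanishes. *)
  have D3_c2 : Delta3 h (c%:Z + 2) = 0.
    by rewrite (_ : c%:Z + 2 = c%:Z + 3 - 1) ?D3_sym ?D3_small ?oppr0 //; lia.
  split; last by lia.
  + split=> [|t [t_le t_neg]]; first by split=> //; lia.
    have t_neq : t != c%:Z + 2 by apply: contraTneq t_neg => ->; rewrite D3_c2 ltxx.
    by have := n1_min t t_neg; have := N1_max t ltac:(split=> //; lia); lia.
  + split=> [|t [t_le t_pos]]; first by split=> //; lia.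
    have := n2_min t ltac:(split=> //; lia); have := N2_max t t_pos; lia.
  + by rewrite -D3_sym; congr Delta3; lia.
- case=> t1 [t2 [[_ t1_uniq] [_ t2_uniq] _ t12]].
  have [n1_neg n1_min] := n1_def; have [[n2_gt0 n2_pos] n2_min] := n2_def.
  (* Places [n2] below [c + 2], so that uniqueness in the range of (4) identifies [t1], [t2] with
     [n1], [n2]. *)
  have := N2_def.2 n2 n2_pos => n2_le.
  apply/rat_multiplicity/lower.
  have t1E : t1 = n1 by apply: t1_uniq; split=> //; lia.
  have t2E : t2 = n2 by apply: t2_uniq; split=> //; lia.
  by rewrite -t1E -t2E.
Qed.
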